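(* Let $\mathcal H,\mathfrak H$ be complex separable Hilbert spaces, let $A$ be a densely defined, symmetric operator acting in $\mathcal H$ with $\dim\ker(A^*-i)=\dim\ker(A^*+i)$, and let $(\mathfrak H,\Gamma_1,\Gamma_2)$ be a boundary triple for $A$, with $\operatorname{Tr}_{\mathfrak H}:=(\Gamma_1,\Gamma_2):\operatorname{dom}(A^* )\to\mathfrak H\times\mathfrak H$. Let $\mathscr D\subset\operatorname{dom}(A^* )$ and let $A_{\mathscr D}$ be the operator acting in $\mathcal H$ by $A_{\mathscr D}u=A^*u$, $u\in\operatorname{dom}(A_{\mathscr D}):=\mathscr D$. If $A_{\mathscr D}$ is self-adjoint, then $$\operatorname{Tr}_{\mathfrak H}(\mathscr D)=\{(\Gamma_1u,\Gamma_2u):u\in\mathscr D\}\subset\mathfrak H\times\mathfrak H$$ is Lagrangian with respect to the symplectic form $\omega_{\mathfrak H}$. Conversely, if $\mathcal G\subset\mathfrak H\times\mathfrak H$ is Lagrangian, then the operator $A_{\operatorname{Tr}^{-1}_{\mathfrak H}(\mathcal G)}$ acting in $\mathcal H$ by $A_{\operatorname{Tr}^{-1}_{\mathfrak H}(\mathcal G)}u=A^*u$, $u\in\operatorname{dom}(A_{\operatorname{Tr}^{-1}_{\mathfrak H}(\mathcal G)}):=\operatorname{Tr}_{\mathfrak H}^{-1}(\mathcal G)$, is self-adjoint, where $\operatorname{Tr}_{\mathfrak H}^{-1}(\mathcal G)$ denotes the preimage of $\mathcal G$.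
   Context: Boundary triple: $(\mathfrak H,\Gamma_1,\Gamma_2)$ with linear maps $\Gamma_1,\Gamma_2:\operatorname{dom}(A^* )\to\mathfrak H$ is a boundary triple for $A$ if (1) $\langle A^*f,g\rangle_{\mathcal H}-\langle f,A^*g\rangle_{\mathcal H}=\langle\Gamma_1f,\Gamma_2g\rangle_{\mathfrak H}-\langle\Gamma_2f,\Gamma_1g\rangle_{\mathfrak H}$ for all $f,g\in\operatorname{dom}(A^* )$, and (2) $(\Gamma_1,\Gamma_2):\operatorname{dom}(A^* )\to\mathfrak H\times\mathfrak H$ is onto. Symplectic form: $\omega_{\mathfrak H}((f_1,g_1),(f_2,g_2))=\langle f_1,g_2\rangle_{\mathfrak H}-\langle g_1,f_2\rangle_{\mathfrak H}$ on $\mathfrak H\times\mathfrak H$. A subspace $\mathcal F$ is Lagrangian if it equals its annihilator $\{x:\omega_{\mathfrak H}(x,y)=0\ \forall y\in\mathcal F\}$. *)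

(* Defs.v *)
From HB Require Import structures.
From mathcomp Require Import all_boot all_order all_algebra sesquilinear.
From mathcomp Require Import complex.
From mathcomp Require Import all_classical all_reals all_analysis.
Import Order.TTheory GRing.Theory Num.Theory.
Import numFieldNormedType.Exports.

Set Implicit Arguments.
Unset Strict Implicit.
Unset Printing Implicit Defensive.

Local Open Scope classical_set_scope.
Local Open Scope ring_scope.

(* Complex Hilbert spaces: complete normed spaces over R[i] whose norm comes
   from an inner product. MathComp's [{dot V for conjC}] forms are linear in
   the first argument and conjugate-linear in the second one. *)
HB.mixin Record CompleteNormedModule_isHilbert (R : realType) V
    of CompleteNormedModule R[i] V := {
  inner_form : {dot V for (@Num.conj R[i])} ;
  normr_inner_form : forall x : V, `|x| ^+ 2 = inner_form x x
}.

#[short(type="hilbertType")]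
HB.structure Definition Hilbert (R : realType) :=
  {V of CompleteNormedModule R[i] V & CompleteNormedModule_isHilbert R V}.

Definition inner (R : realType) (V : hilbertType R) (x y : V) : R[i] :=
  inner_form x y.

Notation "''[' x , y ]" := (inner x y) : ring_scope.

Definition separable (T : topologicalType) : Prop :=
  exists2 S : set T, countable S & dense S.

Definition subspace (K : pzRingType) (V : lmodType K) (F : set V) : Prop :=
  submod_closed (mem F).

Definition linear_on (K : pzRingType) (V W : lmodType K) (D : set V)
    (f : V -> W) : Prop :=
  forall (a : K) (u v : V), D u -> D v -> f (a *: u + v) = a *: f u + f v.

Definition orthonormal_set (R : realType) (V : hilbertType R) (E : set V) :=
  forall x y : V, E x -> E y -> '[x, y] = (x == y)%:R.

(* [smallest subspace E] is the linear span of [E]. *)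
Definition orthonormal_basis (R : realType) (V : hilbertType R)
    (F E : set V) : Prop :=
  [/\ E `<=` F, orthonormal_set E & F `<=` closure (smallest (@subspace _ V) E)].

(* Equality of Hilbert dimensions, i.e. of the cardinalities of orthonormal
   bases. *)
Definition same_hilbert_dim (R : realType) (V W : hilbertType R)
    (F : set V) (G : set W) : Prop :=
  exists E1 : set V, exists E2 : set W,
    [/\ orthonormal_basis F E1, orthonormal_basis G E2 & (E1 #= E2)%card].

(* A possibly unbounded operator acting in [V]; the values of the underlying
   function outside [dom] are irrelevant. *)
Record operator (V : Type) := Operator { dom : set V ; app :> V -> V }.

Definition eq_operator (V : Type) (S T : operator V) : Prop :=
  dom S = dom T /\ forall u, dom S u -> S u = T u.

Definition restrict_op (V : Type) (T : operator V) (D : set V) : operator V :=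
  Operator D T.

Section operators.
Variables (R : realType) (V : hilbertType R).
Implicit Types T : operator V.

Definition linear_operator T : Prop :=
  subspace (dom T) /\ linear_on (dom T) T.

Definition densely_defined T : Prop := dense (dom T).

Definition symmetric_op T : Prop :=
  forall f g, dom T f -> dom T g -> '[T f, g] = '[f, T g].

Definition adjoint_value T (g h : V) : Prop :=
  forall f, dom T f -> '[T f, g] = '[f, h].

(* When [T] is densely defined, the [h] chosen by [xget] is unique. *)
Definition adjoint T : operator V :=
  Operator [set g | exists h, adjoint_value T g h]
           (fun g => xget 0 [set h | adjoint_value T g h]).

Definition self_adjoint T : Prop :=
  [/\ linear_operator T, densely_defined T & eq_operator T (adjoint T)].

Definition ker_shift T (z : R[i]) : set V :=
  [set f | dom T f /\ T f - z *: f = 0].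

End operators.

Section boundary_triples.
Variables (R : realType) (V W : hilbertType R).

Definition trace (G1 G2 : V -> W) (u : V) : W * W := (G1 u, G2 u).

(* [G1] and [G2] are only meaningful on [dom (adjoint A)]. *)
Definition boundary_triple (A : operator V) (G1 G2 : V -> W) : Prop :=
  let A' := adjoint A in
  [/\ linear_on (dom A') G1, linear_on (dom A') G2,
      forall f g, dom A' f -> dom A' g ->
        '[A' f, g] - '[f, A' g] = '[G1 f, G2 g] - '[G2 f, G1 g]
    & set_surj (dom A') [set: W * W] (trace G1 G2)].

Definition trace_preimage (A : operator V) (G1 G2 : V -> W)
    (G : set (W * W)) : set V :=
  dom (adjoint A) `&` trace G1 G2 @^-1` G.

Definition symplectic_form (x y : W * W) : R[i] :=
  '[x.1, y.2] - '[x.2, y.1].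

Definition annihilator (F : set (W * W)) : set (W * W) :=
  [set x | forall y, F y -> symplectic_form x y = 0].

Definition lagrangian (F : set (W * W)) : Prop :=
  subspace F /\ F = annihilator F.

End boundary_triples.

(* Main.v *)
Require Import Defs.
From mathcomp Require Import sesquilinear.
From mathcomp Require Import all_boot all_order all_algebra complex.
From mathcomp Require Import all_classical all_reals all_analysis.
Import Order.TTheory GRing.Theory Num.Theory.
Import numFieldNormedType.Exports.

Set Implicit Arguments.
Unset Strict Implicit.
Unset Printing Implicit Defensive.

Local Open Scope classical_set_scope.
Local Open Scope ring_scope.

(** Write [A'] for the adjoint of [A] and [Tr] for [trace G1 G2].  Green's
identity says that [Tr] turns the boundary form
  [(f, g) |-> '[A' f, g] - '[f, A' g]]
of [A'] into the symplectic form of [W * W] ([symplectic_form_trace]).  So for a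
domain [D] contained in [dom A'], the restriction of [A'] to [D] is symmetric
exactly when [Tr D] is isotropic, and since [Tr] is onto, maximality on one side
can be transported to the other.

If the restriction of [A'] to [D] is self-adjoint, an element of the annihilator
of [Tr D] is [Tr f] for some [f] in [dom A'], and the vanishing of the boundary
form between [f] and [D] puts [f] in the domain of the adjoint of the
restriction, which is [D] ([lagrangian_trace]).

Conversely, let [G] be Lagrangian and [D] the preimage of [G].  The boundary form
vanishes between [dom A] and [dom A'], so by surjectivity of [Tr] and
nondegeneracy of the symplectic form [Tr] vanishes on [dom A]
([trace_eq0_on_dom]).  Hence [dom A] is contained in [D]; this makes [D] dense,
and the adjoint of the restriction to [D] is itself a restriction of [A'].  Green's
identity then says that [g] is in its domain exactly when [Tr g] annihilates [G],
that is, when [g] is in [D] ([self_adjoint_trace_preimage]). *)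

(** * Inner products and dense sets *)

Section InnerProduct.
Context {R : realType} {V : hilbertType R}.
Implicit Types x y z : V.

Lemma innerPl (a : R[i]) x y z : '[a *: x + y, z] = a * '[x, z] + '[y, z].
Proof. exact: linearPl. Qed.

Lemma innerBl x y z : '[x - y, z] = '[x, z] - '[y, z].
Proof. exact: linearBl. Qed.

Lemma innerC x y : '[x, y] = Num.conj '[y, x].
Proof. by rewrite /inner hermC expr0 mul1r. Qed.

Lemma innerPr (a : R[i]) x y z :
  '[x, a *: y + z] = Num.conj a * '[x, y] + '[x, z].
Proof.
by rewrite innerC innerPl rmorphD rmorphM /= -!innerC.
Qed.

Lemma innerBr x y z : '[x, y - z] = '[x, y] - '[x, z].
Proof. exact: linearBr. Qed.

Lemma inner0r x : '[x, 0] = 0.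
Proof. exact: linear0r. Qed.

Lemma inner_normr x : '[x, x] = `|x| ^+ 2.
Proof. by rewrite normr_inner_form. Qed.

Lemma inner_self_eq0 x : '[x, x] = 0 -> x = 0.
Proof.
by rewrite inner_normr => /eqP; rewrite expf_eq0 /= normr_eq0 => /eqP.
Qed.

(** By Pythagoras, a vector [x] orthogonal to [D] satisfies [`|x| <= `|x - d|]
for all [d] in [D]; if [x] were not zero, the open ball of radius [`|x|] around
[x] would miss [D]. *)
Lemma orthogonal_dense_eq0 (D : set V) x :
  dense D -> (forall d, D d -> '[d, x] = 0) -> x = 0.
Proof.
move=> dD Dx; apply/eqP/negPn/negP => x0.
have [|d [xd Dd]] := dD (ball x `|x|) _ (ball_open _ _).
  by exists x; apply: ballxx; rewrite normr_gt0.
move: xd; rewrite -ball_normE /= => xd.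
have : `|x - d| ^+ 2 < `|x| ^+ 2 by rewrite ltrXn2r.
rewrite -!inner_normr innerBl !innerBr (innerC x d) (Dx d) // rmorph0 subr0 sub0r opprK.
by rewrite gtrDl inner_normr le_gtF ?exprn_ge0.
Qed.

End InnerProduct.

Section Subspaces.
Context {K : pzRingType} {V W : lmodType K}.

Lemma subspaceP (F : set V) :
  Defs.subspace F <-> F 0 /\ forall a u v, F u -> F v -> F (a *: u + v).
Proof.
split=> -[F0 FP]; split.
- by move: F0; rewrite in_setE.
- by move=> a u v Fu Fv; have := FP a u v; rewrite !in_setE; apply.
- by rewrite in_setE.
- by move=> a u v; rewrite !in_setE; exact: FP.
Qed.

Lemma linear_on0 (D : set V) (f : V -> W) : linear_on D f -> D 0 -> f 0 = 0.
Proof.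
by move=> fP D0; have := fP (-1) 0 0 D0 D0; rewrite scaler0 addr0 scaleN1r addNr.
Qed.

End Subspaces.

(** * Adjoints *)

Section Adjoint.
Context {R : realType} {V : hilbertType R}.
Implicit Types T : operator V.

Lemma adjoint_value_app T g : dom (adjoint T) g -> adjoint_value T g (adjoint T g).
Proof. exact: xgetPex. Qed.

Lemma adjoint_value_unique T g h k : densely_defined T ->
  adjoint_value T g h -> adjoint_value T g k -> h = k.
Proof.
move=> dT hP kP; apply/eqP; rewrite -subr_eq0; apply/eqP.
apply: (orthogonal_dense_eq0 dT) => d Td.
by rewrite innerBr -hP // -kP // subrr.
Qed.

Lemma adjoint_valueE T g h : densely_defined T ->
  adjoint_value T g h -> adjoint T g = h.
Proof.
move=> dT hP; apply: (adjoint_value_unique dT _ hP).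
by apply: adjoint_value_app; exists h.
Qed.

Lemma linear_adjoint T : densely_defined T -> linear_operator (adjoint T).
Proof.
move=> dT.
have valP a u v h k : adjoint_value T u h -> adjoint_value T v k ->
    adjoint_value T (a *: u + v) (a *: h + k).
  by move=> uh vk f Tf; rewrite !innerPr uh // vk.
split.
  apply/subspaceP; split.
    by exists 0 => f _; rewrite !inner0r.
  by move=> a u v [h uh] [k vk]; exists (a *: h + k); exact: valP.
move=> a u v Du Dv; apply: adjoint_valueE => //.
by apply: valP; exact: adjoint_value_app.
Qed.

Lemma linear_restrict_op T (D : set V) : linear_operator T ->
  D `<=` dom T -> Defs.subspace D -> linear_operator (restrict_op T D).
Proof. by move=> [_ Tl] DT Ds; split=> // a u v /DT Du /DT Dv; exact: Tl. Qed.

Lemma symmetric_adjoint_value T g : symmetric_op T -> dom T g ->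
  adjoint_value T g (T g).
Proof. by move=> Ts Tg f Tf; exact: Ts. Qed.

(** For a symmetric densely defined operator, self-adjointness only has to be
checked on domains: the adjoint already extends the operator. *)
Lemma self_adjoint_maximal T : linear_operator T -> densely_defined T ->
  symmetric_op T -> dom (adjoint T) `<=` dom T -> self_adjoint T.
Proof.
move=> Tl dT Ts TT; split=> //; split.
  by apply/seteqP; split=> // g Tg; exists (T g); exact: symmetric_adjoint_value.
by move=> g Tg; rewrite (adjoint_valueE dT (symmetric_adjoint_value Ts Tg)).
Qed.

Lemma self_adjoint_symmetric T : self_adjoint T -> symmetric_op T.
Proof.
move=> [_ _ [domE appE]] f g Tf Tg; rewrite (appE g Tg).
by apply: adjoint_value_app => //; rewrite -domE.
Qed.

End Adjoint.

(** * The symplectic form *)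

Section Symplectic.
Context {R : realType} {W : hilbertType R}.
Implicit Types x y : W * W.

Lemma symplectic_form_conj x y : symplectic_form x y = - Num.conj (symplectic_form y x).
Proof. by rewrite /symplectic_form rmorphB opprB /= -!innerC. Qed.

Lemma symplectic_form_eq0C x y : symplectic_form x y = 0 -> symplectic_form y x = 0.
Proof. by move=> xy; rewrite symplectic_form_conj xy rmorph0 oppr0. Qed.

Lemma symplectic_form_nondegenerate x : (forall y, symplectic_form x y = 0) -> x = 0.
Proof.
case: x => x1 x2 x0.
(* [(0, x1)] and [(x2, 0)] pair with [x] to [`|x1| ^+ 2] and [- `|x2| ^+ 2]. *)
have := x0 (0, x1); rewrite /symplectic_form /= inner0r subr0 => /inner_self_eq0 ->.
have := x0 (x2, 0); rewrite /symplectic_form /= inner0r sub0r.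
by move/eqP; rewrite oppr_eq0 => /eqP /inner_self_eq0 ->.
Qed.

End Symplectic.

(** * Boundary triples *)

Section BoundaryTriple.
Context {R : realType} {V W : hilbertType R}.
Variables (A : operator V) (G1 G2 : V -> W).
Hypothesis triple : boundary_triple A G1 G2.

Local Notation A' := (adjoint A).
Local Notation Tr := (trace G1 G2).

Lemma symplectic_form_trace f g : dom A' f -> dom A' g ->
  symplectic_form (Tr f) (Tr g) = '[A' f, g] - '[f, A' g].
Proof. by case: triple => _ _ green _ fA gA; rewrite green. Qed.

Lemma trace_surj x : exists2 f, dom A' f & Tr f = x.
Proof. by case: triple => _ _ _ /(_ x I). Qed.

Lemma linear_trace : linear_on (dom A') Tr.
Proof.
case: triple => l1 l2 _ _ a u v Du Dv.
by rewrite /trace l1 // l2.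
Qed.

(** A vector annihilating [Tr D] lifts along [Tr] to some [f] in [dom A'], and
Green's identity makes [A' f] an adjoint value at [f] of the restriction to [D],
so that self-adjointness puts [f] in [D]. *)
Lemma lagrangian_trace (D : set V) : D `<=` dom A' ->
  self_adjoint (restrict_op A' D) -> lagrangian (Tr @` D).
Proof.
move=> DA saD; have symD := self_adjoint_symmetric saD.
have [[/subspaceP[D0 DP] _] _ [domD _]] := saD.
split.
  apply/subspaceP; split.
    by exists 0 => //; rewrite (linear_on0 linear_trace) //; exact: DA.
  move=> a _ _ [u Du <-] [v Dv <-]; exists (a *: u + v); first exact: DP.
  by rewrite linear_trace //; exact: DA.
apply/seteqP; split.
  move=> _ [f Df <-] _ [g Dg <-].
  rewrite symplectic_form_trace; [|exact: DA..].
  by apply/eqP; rewrite subr_eq0; apply/eqP; exact: symD.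
move=> x xP; have [f Af fx] := trace_surj x; exists f => //.
suff : dom (adjoint (restrict_op A' D)) f by rewrite -domD.
exists (A' f) => g Dg; apply/eqP; rewrite -subr_eq0 -symplectic_form_trace //.
  by apply/eqP/symplectic_form_eq0C; rewrite fx; apply: xP; exists g.
exact: DA.
Qed.

Hypotheses (denseA : densely_defined A) (symA : symmetric_op A).

Lemma dom_sub_adjoint : dom A `<=` dom A'.
Proof. by move=> f Af; exists (A f); exact: symmetric_adjoint_value. Qed.

(** The boundary form vanishes between [dom A] and [dom A'] by the definition of
the adjoint, and [Tr] reaches every vector of [W * W]. *)
Lemma trace_eq0_on_dom f : dom A f -> Tr f = 0.
Proof.
move=> Af; apply: symplectic_form_nondegenerate => y.
have [g A'g <-] := trace_surj y.
rewrite symplectic_form_trace //; last exact: dom_sub_adjoint.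
rewrite (adjoint_valueE denseA (symmetric_adjoint_value symA Af)).
by rewrite (adjoint_value_app A'g) // subrr.
Qed.

(** Since [dom A] is contained in the preimage [D], any adjoint value of the
restriction to [D] is also one of [A]; this brings the domain of the adjoint
inside [dom A'], where Green's identity and [G = annihilator G] apply. *)
Lemma self_adjoint_trace_preimage (G : set (W * W)) : lagrangian G ->
  self_adjoint (restrict_op A' (trace_preimage A G1 G2 G)).
Proof.
move=> [/subspaceP[G0 GP] GE]; set D := trace_preimage A G1 G2 G.
have DA : D `<=` dom A' by move=> u [].
have A'lin := linear_adjoint denseA.
have [/subspaceP[A'0 A'P] _] := A'lin.
have AD : dom A `<=` D.
  move=> f Af; split; first exact: dom_sub_adjoint.
  by rewrite /= trace_eq0_on_dom.
apply: self_adjoint_maximal.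
- apply: linear_restrict_op => //; apply/subspaceP; split.
    by split=> //=; rewrite (linear_on0 linear_trace).
  move=> a u v [Au Gu] [Av Gv]; split; first exact: A'P.
  by rewrite /= linear_trace //; exact: GP.
- by move=> O O0 Oo; have [f [Of /AD Df]] := denseA O0 Oo; exists f.
- move=> f g [Af Gf] [Ag Gg]; apply/eqP; rewrite -subr_eq0 /=.
  rewrite -symplectic_form_trace //; apply/eqP.
  by move: Gf; rewrite /= GE; apply.
move=> g [h gh].
have A'gh : adjoint_value A g h.
  move=> f Af; rewrite -(adjoint_valueE denseA (symmetric_adjoint_value symA Af)).
  exact: gh (AD _ Af).
have A'g : dom A' g by exists h.
split=> //; rewrite /= GE => y Gy; have [f A'f fy] := trace_surj y.
apply: symplectic_form_eq0C; rewrite -fy symplectic_form_trace //.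
rewrite (adjoint_valueE denseA A'gh); apply/eqP; rewrite subr_eq0; apply/eqP.
by apply: gh; split=> //=; rewrite fy.
Qed.

End BoundaryTriple.

Theorem corollary5p4 (R : realType) (V W : hilbertType R)
    (A : operator V) (G1 G2 : V -> W) :
  separable V -> separable W ->
  linear_operator A -> densely_defined A -> symmetric_op A ->
  same_hilbert_dim (ker_shift (adjoint A) 'i) (ker_shift (adjoint A) (- 'i)) ->
  boundary_triple A G1 G2 ->
  (forall D : set V, D `<=` dom (adjoint A) ->
     self_adjoint (restrict_op (adjoint A) D) ->
     lagrangian (trace G1 G2 @` D)) /\
  (forall G : set (W * W), lagrangian G ->
     self_adjoint (restrict_op (adjoint A) (trace_preimage A G1 G2 G))).
Proof.
move=> _ _ _ denseA symA _ triple; split.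
- by move=> D; exact: lagrangian_trace.
- by move=> G; exact: self_adjoint_trace_preimage.
Qed.
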